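(* Let $f':\{0,1\}^n\to\mathbb{R}$ be supermodular. Define $f:\{0,1\}^{n+1}\to\mathbb{R}$ by $$f(x_1,\dots,x_{n-1},x_n,x_{n+1})=\begin{cases} f'(x_1,\dots,x_{n-1},1) & \text{if } x_n=x_{n+1}=1,\\ f'(x_1,\dots,x_{n-1},0)&\text{otherwise.}\end{cases}$$ If $f'$ is skeletal, then $f$ is skeletal.
   Context: For $M=\{1,\dots,m\}$, a subset $S\subseteq M$ is identified with its 0-1 indicator vector $(x_1,\dots,x_m)\in\{0,1\}^m$ ($x_i=1$ iff $i\in S$), so functions on $\{0,1\}^m$ are functions on the power set $\mathcal{P}(M)$. A function $f:\mathcal{P}(M)\to\mathbb{R}$ is supermodular if $f(E\cup F)+f(E\cap F)\ge f(E)+f(F)$ for all $E,F\subseteq M$; $\mathcal{K}(M)$ is the cone of supermodular functions, and $\mathcal{K}_\ell(M)=\{f\in\mathcal{K}(M)\mid f(S)=0\text{ for }|S|\le 1\}$ is the (pointed polyhedral) cone of standardized supermodular functions. The standardization of $f\in\mathcal{K}(M)$ is $\bar f(E)=f(E)-f(\emptyset)-\sum_{e\in E}(f(\{e\})-f(\emptyset))$. A function $f\in\mathcal{K}(M)$ is called skeletal if its standardization $\bar f$ is an extreme ray of $\mathcal{K}_\ell(M)$. An extreme ray of a polyhedral convex cone is a half line, and saying that $u$ is an extreme ray of a cone means that $\{cu\mid c\ge 0\}$ is an extreme ray of the cone.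
   Formalization: The formal statement adds the hypothesis f'({n}) = f'(∅); without it the claim fails, e.g. f'(x1,x2) = x1x2 − x2 is skeletal but f = x1x2x3 − x2x3 is not supermodular, and for skeletal f' the conclusion holds only under this condition. *)

(* Defs.v *)
From HB Require Import structures.
From mathcomp Require Import all_boot all_order all_algebra.
From mathcomp Require Import reals.

Set Implicit Arguments.
Unset Strict Implicit.
Unset Printing Implicit Defensive.

Import Order.TTheory GRing.Theory Num.Theory.
Local Open Scope ring_scope.

(* M = {1, ..., m} is 'I_m (0-based), and {0,1}^m is m.-tuple bool. *)

Definition indicator (m : nat) (S : {set 'I_m}) : m.-tuple bool :=
  [tuple i \in S | i < m].

Definition set_function (R : realType) (m : nat) (f : m.-tuple bool -> R) :
    {ffun {set 'I_m} -> R} :=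
  [ffun S => f (indicator S)].

Definition supermodular (R : realType) (m : nat)
    (f : {ffun {set 'I_m} -> R}) : Prop :=
  forall E F : {set 'I_m}, f E + f F <= f (E :|: F) + f (E :&: F).

Definition std_supermodular (R : realType) (m : nat)
    (f : {ffun {set 'I_m} -> R}) : Prop :=
  supermodular f /\ (forall S : {set 'I_m}, (#|S| <= 1)%N -> f S = 0).

Definition standardization (R : realType) (m : nat)
    (f : {ffun {set 'I_m} -> R}) : {ffun {set 'I_m} -> R} :=
  [ffun E : {set 'I_m} =>
     f E - f set0 - \sum_(e in E) (f [set e] - f set0)].

Definition half_line (R : realType) (V : lmodType R) (u v : V) : Prop :=
  exists2 c : R, 0 <= c & v = c *: u.

(* The set {c u | c >= 0} is a genuine half line (hence u <> 0), is contained
   in the convex cone C, and is a face of C: a sum of two elements of C lies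
   on it only if both summands do. *)
Definition extreme_ray (R : realType) (V : lmodType R) (C : V -> Prop)
    (u : V) : Prop :=
  [/\ u != 0,
      forall v, half_line u v -> C v
    & forall x y, C x -> C y -> half_line u (x + y) ->
        half_line u x /\ half_line u y].

(* The codomain is written R^o only to obtain the pointwise lmodType R structure
   on the space of real-valued set functions. *)
Definition skeletal (R : realType) (m : nat)
    (f : {ffun {set 'I_m} -> R}) : Prop :=
  supermodular f /\
  extreme_ray (V := {ffun {set 'I_m} -> R^o}) (@std_supermodular R m)
    (standardization f).

(* Main.v *)
(** Merging [x_n] and [x_(n+1)] is a surjection [g] on index sets, and [f] is [f']
    composed with the right adjoint [fiber_core g] of the preimage map of [g].
    The normalization makes standardization commute with this composition; let
    [h] be the standardization of [f'].  Standardized supermodular functions are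
    nonnegative and monotone.  Hence when [x + y] is a multiple of
    [h \o fiber_core g], monotonicity forces [x] and [y] themselves to factor
    through [fiber_core g], and nonnegativity makes their factors standardized;
    extremality of [h] then applies to these factors. *)
Require Import Defs.
From mathcomp Require Import all_boot all_order all_algebra.
From mathcomp Require Import reals lra.
Import Order.TTheory GRing.Theory Num.Theory.
Local Open Scope ring_scope.

(** * Standardized supermodular functions *)

Section Standardized.
Context {R : realType} {m : nat}.
Implicit Types (f x : {ffun {set 'I_m} -> R}) (A B E S : {set 'I_m}).

(** Removing one point [e] from [B] suffices, by induction on the size of [B :\: A]: supermodularity
    is applied to the disjoint sets [B :\ e] and [[set e]], and [x] vanishes on [[set e]] and on
    [set0]. *)
Lemma std_supermodular_homo x :
  std_supermodular x -> {homo x : A B / A \subset B >-> A <= B}.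
Proof.
move=> [x_sup x_std] A B; have [k] := ubnP #|B :\: A|.
elim: k B => // k IHk B; rewrite ltnS => leBk sAB.
have [/eqP|[e eBA]] := set_0Vmem (B :\: A).
  by rewrite setD_eq0 => sBA; have /eqP -> : A == B by rewrite eqEsubset sAB.
have [eA eB] : e \notin A /\ e \in B by move: eBA; rewrite inE => /andP[].
have sAB' : A \subset B :\ e by rewrite subsetD1 sAB.
apply: le_trans (IHk _ _ sAB') _.
  apply: leq_trans leBk; apply: proper_card; apply/properP; split.
    by apply/subsetP => i; rewrite !inE => /and3P[-> _ ->].
  by exists e => //; rewrite !inE eqxx andbF.
have := x_sup (B :\ e) [set e].
rewrite setUC setD1K // (x_std [set e]) ?cards1 // addr0.
suff -> : (B :\ e) :&: [set e] = set0 by rewrite (x_std set0) ?cards0 ?addr0.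
by apply/setP => i; rewrite !inE; case: (i == e); rewrite ?andbF.
Qed.

Lemma std_supermodular_ge0 x A : std_supermodular x -> 0 <= x A.
Proof.
move=> x_std; rewrite -(x_std.2 set0) ?cards0 //.
by apply: std_supermodular_homo (sub0set A).
Qed.

Lemma standardization_small f S : (#|S| <= 1)%N -> standardization f S = 0.
Proof.
rewrite ffunE leq_eqVlt ltnS leqn0 => /orP[/cards1P[e ->]|].
  by rewrite big_set1 subrr.
by rewrite cards_eq0 => /eqP ->; rewrite big_set0 subrr subr0.
Qed.

(** The sum subtracted by [standardization] is modular, and the constant [f set0] occurs twice on
    each side of the inequality. *)
Lemma supermodular_standardization f :
  supermodular (standardization f) <-> supermodular f.
Proof.
pose s E := \sum_(e in E) (f [set e] - f set0).
have sUI E F : s (E :|: F) + s (E :&: F) = s E + s F.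
  rewrite /s ![\sum_(e in _) _]big_mkcond -!big_split /=; apply: eq_bigr => e _.
  by rewrite !inE; case: (e \in E); case: (e \in F); rewrite ?addr0 ?add0r.
split=> f_sup E F; have := f_sup E F; have := sUI E F; rewrite /s !ffunE; lra.
Qed.

Lemma std_supermodular_scale (c : R) (x : {ffun {set 'I_m} -> R^o}) :
  0 <= c -> std_supermodular x -> std_supermodular (c *: x).
Proof.
move=> c_ge0 [x_sup x_std]; split=> [E F|S leS1]; rewrite !ffunE.
  by have := ler_wpM2l c_ge0 (x_sup E F); rewrite !mulrDr.
by rewrite (x_std S leS1) scaler0.
Qed.

End Standardized.

(** * Pulling set functions back along a surjection of index sets *)

Section FiberCore.
Context {k m : nat} (g : 'I_k -> 'I_m).
Hypothesis g_surj : forall j, exists i, g i = j.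
Implicit Types (E F : {set 'I_k}) (S : {set 'I_m}).

Definition fiber_core E : {set 'I_m} := [set j | [forall (i | g i == j), i \in E]].

Lemma fiber_coreP E j : reflect (forall i, g i = j -> i \in E) (j \in fiber_core E).
Proof.
rewrite inE; apply: (iffP forall_inP) => H i; last by move/eqP; apply: H.
by move=> gi; apply: H; apply/eqP.
Qed.

Lemma fiber_coreI E F : fiber_core (E :&: F) = fiber_core E :&: fiber_core F.
Proof.
apply/setP => j; rewrite in_setI.
apply/fiber_coreP/andP => [H|[/fiber_coreP HE /fiber_coreP HF] i gi].
  by split; apply/fiber_coreP => i /H; rewrite inE => /andP[].
by rewrite inE HE ?HF.
Qed.

Lemma fiber_coreU E F : fiber_core E :|: fiber_core F \subset fiber_core (E :|: F).
Proof.
apply/subsetP => j; rewrite in_setU => /orP[] /fiber_coreP H;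
  by apply/fiber_coreP => i /H; rewrite inE => ->; rewrite ?orbT.
Qed.

Lemma fiber_core_preim S : fiber_core (g @^-1: S) = S.
Proof.
apply/setP => j; apply/fiber_coreP/idP => [H|jS i gi]; last by rewrite inE gi.
by have [i gi] := g_surj j; have := H i gi; rewrite inE gi.
Qed.

Lemma preim_fiber_core E : g @^-1: fiber_core E \subset E.
Proof. by apply/subsetP => i; rewrite in_set => /fiber_coreP; apply. Qed.

Lemma fiber_core_imset E : fiber_core E \subset g @: E.
Proof.
apply/subsetP => j /fiber_coreP jE; have [i gi] := g_surj j.
by apply/imsetP; exists i => //; apply: jE.
Qed.

Lemma fiber_core0 : fiber_core set0 = set0.
Proof. by rewrite -[set0 in LHS](preimset0 g) fiber_core_preim. Qed.

Context {R : realType}.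
Implicit Types (f : {ffun {set 'I_m} -> R}) (x y : {ffun {set 'I_k} -> R}).

Definition pull_core f : {ffun {set 'I_k} -> R} :=
  [ffun E => f (fiber_core E)].

Definition pull_preim x : {ffun {set 'I_m} -> R} :=
  [ffun S : {set _} => x (g @^-1: S)].

(** [fiber_core] commutes with intersections but only satisfies an inclusion for unions;
    monotonicity of [f] absorbs the defect. *)
Lemma std_supermodular_pull_core f :
  std_supermodular f -> std_supermodular (pull_core f).
Proof.
move=> f_std; split=> [E F|S leS1]; rewrite !ffunE.
  rewrite fiber_coreI; apply: le_trans (f_std.1 _ _) _.
  by rewrite lerD2r; apply: std_supermodular_homo (fiber_coreU E F).
apply: f_std.2; apply: leq_trans (subset_leq_card (fiber_core_imset S)) _.
exact: leq_trans (leq_imset_card _ _) leS1.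
Qed.

(** The two sums are compared fiber by fiber. A one-point fiber gives the same term on both sides.
    Over a larger fiber the left terms vanish because singletons have empty core, and the right term
    vanishes by the normalization of [f]. *)
Lemma standardization_pull_core f :
  (forall i1 i2, i1 != i2 -> g i1 = g i2 -> f [set g i1] = f set0) ->
  standardization (pull_core f) = pull_core (standardization f).
Proof.
move=> f_norm; apply/ffunP => E; rewrite !ffunE fiber_core0; congr (_ - _).
rewrite (partition_big g xpredT) //= [RHS]big_mkcond /=.
apply: eq_bigr => j _; have [i gi] := g_surj j.
have [i_uniq|] := boolP [forall (i' | g i' == j), i' == i].
  have gE i' : (g i' == j) = (i' == i).
    by apply/idP/eqP => [/(forall_inP i_uniq)/eqP|->]; rewrite ?gi.
  have coreE F : (j \in fiber_core F) = (i \in F).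
    by apply/fiber_coreP/idP => [|iF i' /eqP]; [apply|rewrite gE => /eqP ->].
  rewrite coreE; under eq_bigl => i' do rewrite gE andbC.
  case: ifP => iE; last by rewrite big1 // => i' /andP[/eqP ->]; rewrite iE.
  rewrite (big_pred1 i) => [|i']; last by rewrite /= ; case: eqP => // ->.
  rewrite ffunE (_ : fiber_core [set i] = [set j]) //.
  apply/eqP; rewrite eqEsubset sub1set coreE set11 andbT.
  by rewrite -gi -imset_set1 fiber_core_imset.
rewrite negb_forall_in => /existsP[i2 /andP[/eqP gi2 i2i]].
have fj : f [set j] = f set0 by rewrite -gi2 (f_norm i2 i) // gi.
rewrite fj subrr if_same big1 // => e /andP[_ /eqP ge]; rewrite ffunE.
suff -> : fiber_core [set e] = set0 by rewrite subrr.
(* A point of this core must be [g e], that is [j], so the distinct points [i] and [i2] of its fiber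
   would both equal [e]. *)
apply/eqP; rewrite -subset0; apply/subsetP => j' core_j'.
have /imsetP[e' /set1P -> j'E] := subsetP (fiber_core_imset _) _ core_j'.
move/fiber_coreP: core_j' => core_j'; case/negP: i2i.
have /set1P -> : i2 \in [set e] by apply: core_j'; rewrite gi2 j'E.
by have /set1P -> : i \in [set e] by apply: core_j'; rewrite gi j'E.
Qed.

(** The sum of [x] and [y] takes the same value on [E] and on its subset [g @^-1: fiber_core E].
    Both functions are monotone, so neither changes between these two sets. On small sets, two
    nonnegative values with sum zero are both zero. *)
Lemma pull_preim_sum_core x y f :
  std_supermodular x -> std_supermodular y -> std_supermodular f ->
  (forall E, x E + y E = pull_core f E) ->
  std_supermodular (pull_preim x) /\ x = pull_core (pull_preim x).
Proof.
move=> x_std y_std f_std xyE; split; first split=> [S T|S leS1].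
- by rewrite !ffunE preimsetU preimsetI; apply: x_std.1.
- have := xyE (g @^-1: S); rewrite !ffunE fiber_core_preim f_std.2 //.
  have := std_supermodular_ge0 x (g @^-1: S) x_std.
  have := std_supermodular_ge0 y (g @^-1: S) y_std.
  lra.
apply/ffunP => E; rewrite !ffunE.
have := xyE E; have := xyE (g @^-1: fiber_core E).
rewrite !ffunE fiber_core_preim.
have := std_supermodular_homo x x_std _ _ (preim_fiber_core E).
have := std_supermodular_homo y y_std _ _ (preim_fiber_core E).
lra.
Qed.

Lemma extreme_ray_pull_core f :
  extreme_ray (V := {ffun {set 'I_m} -> R^o}) (@std_supermodular R m) f ->
  extreme_ray (V := {ffun {set 'I_k} -> R^o}) (@std_supermodular R k)
    (pull_core f).
Proof.
move=> [f_neq0 f_ray f_face].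
have f_std : std_supermodular f.
  by apply: f_ray; exists 1; rewrite ?ler01 ?scale1r.
split=> [|v [c c_ge0 ->]|x y x_std y_std [c c_ge0 xyE]].
(* Evaluation at preimages recovers [f], so [pull_core] is injective. *)
- apply: contra_neq f_neq0 => /ffunP f0; apply/ffunP => S.
  by have := f0 (g @^-1: S); rewrite !ffunE fiber_core_preim.
- exact/std_supermodular_scale/std_supermodular_pull_core.
pose cf : {ffun {set 'I_m} -> R^o} := c *: (f : {ffun {set 'I_m} -> R^o}).
have cf_std : std_supermodular cf by apply: std_supermodular_scale.
have xyE' E : x E + y E = pull_core cf E.
  by have /ffunP/(_ E) := xyE; rewrite !ffunE.
have yxE' E : y E + x E = pull_core cf E by rewrite addrC xyE'.
have [x'_std xE] := pull_preim_sum_core _ _ _ x_std y_std cf_std xyE'.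
have [y'_std yE] := pull_preim_sum_core _ _ _ y_std x_std cf_std yxE'.
have /(f_face _ _ x'_std y'_std) [[a a0 xa] [b b0 yb]] :
    half_line (V := {ffun {set 'I_m} -> R^o}) f
      ((pull_preim x : {ffun {set 'I_m} -> R^o}) + pull_preim y).
  exists c => //; apply/ffunP => S.
  by have := xyE' (g @^-1: S); rewrite !ffunE fiber_core_preim.
split; [exists a => //; rewrite xE xa | exists b => //; rewrite yE yb];
  by apply/ffunP => E; rewrite !ffunE.
Qed.

Lemma skeletal_pull_core f :
  (forall i1 i2, i1 != i2 -> g i1 = g i2 -> f [set g i1] = f set0) ->
  skeletal f -> skeletal (pull_core f).
Proof.
move=> /standardization_pull_core stdE [f_sup f_ext].
split; last by rewrite stdE; apply: extreme_ray_pull_core.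
(* [f] itself need not be monotone, so supermodularity is pulled back for its standardization and
   then transferred. *)
apply/supermodular_standardization; rewrite stdE.
apply: (std_supermodular_pull_core _ _).1; split.
  exact/supermodular_standardization.
exact: standardization_small.
Qed.

End FiberCore.

(** * Merging the last two coordinates *)

Definition merge_last (n : nat) (i : 'I_n.+2) : 'I_n.+1 := inord (minn i n).

Lemma val_merge_last n (i : 'I_n.+2) : merge_last n i = minn i n :> nat.
Proof. by rewrite inordK // ltnS geq_minr. Qed.

Lemma merge_last_surj n (j : 'I_n.+1) : exists i, merge_last n i = j.
Proof.
exists (widen_ord (leqnSn _) j); apply: ord_inj; rewrite val_merge_last /=.
by apply/minn_idPl; rewrite -ltnS.
Qed.

(** With 0-based indices, [minn i n] identifies only [n] and [n.+1]. The normalization required by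
    [skeletal_pull_core] thus reduces to one equation, at [ord_max]. *)
Lemma merge_last_fiber n (i1 i2 : 'I_n.+2) :
  i1 != i2 -> merge_last n i1 = merge_last n i2 -> merge_last n i1 = ord_max.
Proof.
rewrite -val_eqE /= => ne12 /(congr1 (@nat_of_ord _)); rewrite !val_merge_last => e12.
apply: ord_inj; rewrite val_merge_last /=.
move: ne12 e12; rewrite /minn; case: ltnP => // _; case: ltnP => //.
by move=> _ ne12 e12; rewrite e12 eqxx in ne12.
Qed.

(** This links [fiber_core] to the coordinate formula for [f]: the last index lies in the core
    exactly when both merged indices lie in [E], which is the conjunction [a && b]. *)
Lemma indicator_merge_last n (E : {set 'I_n.+2}) :
  exists x : n.-tuple bool, exists a b : bool,
    indicator E = [tuple of rcons (rcons x a) b] /\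
    indicator (fiber_core (merge_last n) E) = [tuple of rcons x (a && b)].
Proof.
pose w (i : 'I_n) : 'I_n.+2 := widen_ord (leqW (leqnSn n)) i.
pose p : 'I_n.+2 := widen_ord (leqnSn _) ord_max.
exists [tuple w i \in E | i < n], (p \in E), (ord_max \in E); split.
  apply: eq_from_tnth => i; rewrite tnth_mktuple (tnth_nth false) /=.
  rewrite !nth_rcons size_rcons size_map size_enum_ord.
  case: (ltngtP i n) => [lt_in|gt_in|i_n].
  - rewrite ltnS (ltnW lt_in) (nth_map (Ordinal lt_in)) ?size_enum_ord //.
    by congr (_ \in E); apply: ord_inj; rewrite /= nth_enum_ord.
  - have i_max : i = ord_max.
      by apply: val_inj; apply/eqP; rewrite eqn_leq gt_in -ltnS ltn_ord.
    by rewrite i_max ltnn eqxx.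
  - by rewrite i_n ltnSn; congr (_ \in E); apply: val_inj.
apply: eq_from_tnth => j; rewrite tnth_mktuple (tnth_nth false) /=.
rewrite nth_rcons size_map size_enum_ord.
case: (ltngtP j n) => [lt_jn|gt_jn|j_n]; last 1 first.
- apply/fiber_coreP/andP => [H|[pE mE] i].
    by split; apply: H; apply: ord_inj; rewrite val_merge_last /= ?minnn ?j_n //;
      apply/minn_idPr.
  move=> /(congr1 (@nat_of_ord _)); rewrite val_merge_last /= j_n => /minn_idPr.
  rewrite leq_eqVlt => /orP[/eqP n_i|lt_ni].
    by rewrite (_ : i = p) //; apply: val_inj.
  rewrite (_ : i = ord_max) //; apply: val_inj; apply/eqP.
  by rewrite eqn_leq lt_ni -ltnS ltn_ord.
- rewrite (nth_map (Ordinal lt_jn)) ?size_enum_ord //.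
  rewrite (nth_ord_enum _ (Ordinal lt_jn)).
  (* Below [n] the fiber is the single index [w (Ordinal lt_jn)]. *)
  apply/fiber_coreP/idP => [|wE i].
    by apply; apply: ord_inj; rewrite val_merge_last /=; apply/minn_idPl/ltnW.
  move=> /(congr1 (@nat_of_ord _)); rewrite val_merge_last /= /minn.
  case: ltnP => [_ i_j|_ n_j]; last by move: (lt_jn); rewrite -n_j ltnn.
  by rewrite (_ : i = w (Ordinal lt_jn)) //; apply: val_inj.
- by have := ltn_ord j; rewrite ltnNge gt_jn.
Qed.

Theorem proposition4p2 (R : realType) (n : nat)
    (f' : n.+1.-tuple bool -> R) (f : n.+2.-tuple bool -> R)
    (f'_supermodular : supermodular (set_function f'))
    (* f'({n}) = f'(empty set): without this normalization of f' in the split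
       variable the claim fails, e.g. for f' = x1 x2 - x2. *)
    (f'_normalized : set_function f' [set ord_max] = set_function f' set0)
    (f_def : forall (x : n.-tuple bool) (a b : bool),
       f [tuple of rcons (rcons x a) b] =
         if a && b then f' [tuple of rcons x true]
         else f' [tuple of rcons x false]) :
  skeletal (set_function f') -> skeletal (set_function f).
Proof.
suff -> : set_function f = pull_core (merge_last n) (set_function f').
  apply: skeletal_pull_core; first exact: merge_last_surj.
  by move=> i1 i2 ne12 e12; rewrite (merge_last_fiber _ _ _ ne12 e12).
apply/ffunP => E; rewrite !ffunE.
have [x [a [b [-> ->]]]] := indicator_merge_last n E.
by rewrite f_def; case: (a && b).
Qed.
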